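(* Let $d\ge1$ and let $\alpha=(\alpha_1,\dots,\alpha_d)\in\mathbb{R}^d$ be an irrational vector. Let $\gamma$ be a positive number of the form $\gamma = n_0 + n_1\alpha_1 + \cdots + n_d\alpha_d$ with $n_0,\dots,n_d$ integers. Then there exists a parallelepiped $P$ in $\mathbb{R}^d$, spanned by vectors belonging to $\mathbb{Z}\alpha+\mathbb{Z}^d$, such that $P$ is a bounded remainder set (with respect to $\alpha$) and $\operatorname{mes} P = \gamma$.
   Context: A vector $\alpha = (\alpha_1,\dots,\alpha_d) \in \mathbb{R}^d$ is called irrational if $1, \alpha_1, \ldots, \alpha_d$ are linearly independent over $\mathbb{Q}$. We write $\mathbb{Z}\alpha+\mathbb{Z}^d = \{ n\alpha + m : n \in \mathbb{Z}, m \in \mathbb{Z}^d\}$ and $\mathbb{T}^d = \mathbb{R}^d/\mathbb{Z}^d$. For a bounded measurable set $S \subset \mathbb{R}^d$ let $\chi_S(x) = \sum_{k \in \mathbb{Z}^d} \mathbf{1}_S(x+k)$, a $\mathbb{Z}^d$-periodic function regarded as a function on $\mathbb{T}^d$. A bounded measurable set $S \subset \mathbb{R}^d$ is a bounded remainder set (BRS) with respect to $\alpha$ if there is a constant $C = C(S,\alpha)$ such that for every $n \geq 1$ and almost every $x \in \mathbb{T}^d$, $\left| \sum_{k=0}^{n-1} \chi_S(x+k\alpha) - n \operatorname{mes} S \right| \leq C$, where $\operatorname{mes}$ is Lebesgue measure. A parallelepiped spanned by vectors $v_1,\dots,v_d$ is a set of the form $\{ \sum_{k=1}^d t_k v_k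 : 0 \leq t_k < 1 \}$, where $v_1,\dots,v_d$ are linearly independent vectors in $\mathbb{R}^d$. *)

(* Defs.v *)
From HB Require Import structures.
From mathcomp Require Import all_boot all_order all_algebra.
From mathcomp Require Import all_classical all_reals all_analysis.
Import Order.TTheory GRing.Theory Num.Theory.
Import numFieldNormedType.Exports.

Set Implicit Arguments.
Unset Strict Implicit.
Unset Printing Implicit Defensive.

Local Open Scope classical_set_scope.
Local Open Scope ring_scope.

(* The Borel (= product) sigma-algebra on R^n, generated by the coordinates;
   same construction as the library's sigma-algebra on tuples. *)
Definition rV_coord (R : realType) (n : nat) (i : 'I_n) (v : 'rV[R]_n) :
  measurableTypeR R := v ord0 i.

Section measurable_rV.
Context {R : realType} (n : nat).

Let rV_set0 : g_sigma_preimage (@rV_coord R n) set0.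
Proof. exact: sigma_algebra0. Qed.

Let rV_setC A :
  g_sigma_preimage (@rV_coord R n) A -> g_sigma_preimage (@rV_coord R n) (~` A).
Proof. exact: sigma_algebraC. Qed.

Let rV_bigcup (F : _^nat) :
  (forall i, g_sigma_preimage (@rV_coord R n) (F i)) ->
  g_sigma_preimage (@rV_coord R n) (\bigcup_i (F i)).
Proof. exact: sigma_algebra_bigcup. Qed.

HB.instance Definition _ := @isMeasurable.Build
  (measure_tuple_display R.-ocitv.-measurable.-sigma)
  'rV[R]_n (g_sigma_preimage (@rV_coord R n)) rV_set0 rV_setC rV_bigcup.

End measurable_rV.

Lemma measurable_rV_coord (R : realType) n (i : 'I_n) :
  measurable_fun [set: 'rV[R]_n] (rV_coord i).
Proof.
move=> _ Y mY; rewrite setTI; apply: sub_sigma_algebra => /=.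
rewrite -bigcup_seq/=; exists i => /=; first by rewrite mem_index_enum.
by exists Y => //; rewrite setTI.
Qed.

Lemma measurable_fun_rVP (R : realType) d (T : measurableType d) n
    (f : T -> 'rV[R]_n) :
  (forall i, measurable_fun [set: T] (rV_coord i \o f)) ->
  measurable_fun [set: T] f.
Proof.
move=> mf.
have sub : g_sigma_preimage (fun i => rV_coord i \o f) `<=` measurable.
  apply: smallest_sub; first exact: sigma_algebra_measurable.
  rewrite -bigcup_seq/=; apply: bigcup_sub => i _ _ [B mB <-].
  exact: mf.
move=> _ A mA; apply: sub; rewrite g_sigma_preimage_comp.
by exists A.
Qed.

Section rV_cons.
Context {R : realType} (n : nat).

Definition rV_cons (p : measurableTypeR R * 'rV[R]_n) : 'rV[R]_n.+1 :=
  \row_i if unlift ord0 i is Some j then p.2 ord0 j else p.1.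

Definition rV_uncons (v : 'rV[R]_n.+1) : measurableTypeR R * 'rV[R]_n :=
  (v ord0 ord0, \row_i v ord0 (lift ord0 i)).

Lemma rV_cons_coord0 : rV_coord ord0 \o rV_cons = fst.
Proof. by apply/funext => p; rewrite /= /rV_coord mxE unlift_none. Qed.

Lemma rV_cons_coordS (i : 'I_n) :
  rV_coord (lift ord0 i) \o rV_cons = rV_coord i \o snd.
Proof. by apply/funext => p; rewrite /= /rV_coord mxE liftK. Qed.

Lemma rV_consK : cancel rV_cons rV_uncons.
Proof.
move=> [x v]; rewrite /rV_uncons mxE unlift_none; congr pair.
by apply/rowP => i; rewrite !mxE liftK.
Qed.

Lemma measurable_rV_cons : measurable_fun setT rV_cons.
Proof.
apply: measurable_fun_rVP => i; have [j ->|->] := unliftP ord0 i.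
  rewrite rV_cons_coordS; apply: measurableT_comp => //.
  exact: measurable_rV_coord.
by rewrite rV_cons_coord0.
Qed.

Lemma measurable_rV_uncons : measurable_fun setT rV_uncons.
Proof.
apply: measurable_fun_pair; first exact: measurable_rV_coord.
apply: measurable_fun_rVP => i.
rewrite (_ : _ \o _ = rV_coord (lift ord0 i)); last first.
  by apply/funext => v; rewrite /= /rV_coord mxE.
exact: measurable_rV_coord.
Qed.

Variable mu : {sigma_finite_measure set 'rV[R]_n -> \bar R}.

(* The measure lebesgue x mu on R x R^n, transported to R^(n+1). *)
Definition lebesgue_rV_step : set 'rV[R]_n.+1 -> \bar R :=
  pushforward (@lebesgue_measure R \x mu)%E rV_cons.

Let preimage_rV_cons A : measurable A -> measurable (rV_cons @^-1` A).
Proof.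
by move=> mA; rewrite -[X in measurable X]setTI; exact: measurable_rV_cons.
Qed.

Let lebesgue_rV_step0 : lebesgue_rV_step set0 = 0%E.
Proof. by rewrite /lebesgue_rV_step /pushforward preimage_set0 measure0. Qed.

Let lebesgue_rV_step_ge0 A : (0 <= lebesgue_rV_step A)%E.
Proof. by rewrite /lebesgue_rV_step /pushforward measure_ge0. Qed.

Let lebesgue_rV_step_sigma_additive : semi_sigma_additive lebesgue_rV_step.
Proof.
move=> F mF tF mUF; rewrite /lebesgue_rV_step /pushforward preimage_bigcup.
apply: measure_semi_sigma_additive.
- by move=> k; exact: preimage_rV_cons.
- apply/trivIsetP => i j _ _ ij; rewrite -preimage_setI.
  by move/trivIsetP : tF => /(_ _ _ I I ij) ->; rewrite preimage_set0.
- by rewrite -preimage_bigcup; exact: preimage_rV_cons.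
Qed.

HB.instance Definition _ := isMeasure.Build _ _ _ lebesgue_rV_step
  lebesgue_rV_step0 lebesgue_rV_step_ge0 lebesgue_rV_step_sigma_additive.

Let lebesgue_rV_step_sigma_finite : sigma_finite setT lebesgue_rV_step.
Proof.
have /sigma_finiteP[F [TF ndF Foo]] := sigma_finiteT (@lebesgue_measure R).
have /sigma_finiteP[G [TG ndG Goo]] := sigma_finiteT mu.
exists (fun k => rV_uncons @^-1` (F k `*` G k)).
  apply/esym; rewrite -preimage_bigcup -subTset => v _ /=.
  have [k _ Fk] : (\bigcup_k F k) (rV_uncons v).1 by rewrite -TF.
  have [l _ Gl] : (\bigcup_k G k) (rV_uncons v).2 by rewrite -TG.
  exists (maxn k l) => //; split.
  - by move: Fk; exact/subsetPset/ndF/leq_maxl.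
  - by move: Gl; exact/subsetPset/ndG/leq_maxr.
move=> k; have [? ?] := Foo k; have [? ?] := Goo k; split.
  rewrite -[X in measurable X]setTI; apply: measurable_rV_uncons => //.
  exact: measurableX.
rewrite /lebesgue_rV_step /pushforward -comp_preimage.
rewrite (_ : rV_uncons \o rV_cons = id) ?preimage_id.
  by rewrite product_measure1E// lte_mul_pinfty// ge0_fin_numE.
by apply/funext => p; exact: rV_consK.
Qed.

HB.instance Definition _ := Measure_isSigmaFinite.Build _ _ _
  lebesgue_rV_step lebesgue_rV_step_sigma_finite.

End rV_cons.

(* Lebesgue measure on the Borel sets of R^n, as the n-fold iterated product of
   the one-dimensional one. *)
Fixpoint lebesgue_rV (R : realType) (n : nat) :
    {sigma_finite_measure set 'rV[R]_n -> \bar R} :=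
  match n with
  | 0 => \d_(0 : 'rV[R]_0)
  | m.+1 => lebesgue_rV_step (lebesgue_rV R m)
  end.

(* Its completion: mes is a measure on the Lebesgue measurable sets, obtained as
   the Caratheodory-measurable sets of the induced outer measure, exactly as
   completed_lebesgue_measure is in dimension 1. *)
Definition lebesgue_measurable (R : realType) (d : nat) (S : set 'rV[R]_d) :=
  (lebesgue_rV R d)^*%mu.-cara.-measurable S.

Definition mes (R : realType) (d : nat) :=
  @completed_measure_extension _ _ R (lebesgue_rV R d).
Arguments mes : clear implicits.

HB.instance Definition _ (R : realType) (d : nat) := Measure.on (mes R d).

Definition int_rV (R : realType) (d : nat) (m : 'rV[int]_d) : 'rV[R]_d :=
  map_mx intr m.
Arguments int_rV R {d} m.

Definition irrational_rV (R : realType) (d : nat) (alpha : 'rV[R]_d) :=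
  forall (q0 : rat) (q : 'I_d -> rat),
    ratr q0 + \sum_(i < d) ratr (q i) * alpha ord0 i = 0 ->
    q0 = 0 /\ forall i, q i = 0.

Definition Zspan (R : realType) (d : nat) (alpha : 'rV[R]_d) :
    set 'rV[R]_d :=
  [set v | exists (n : int) (m : 'rV[int]_d), v = n%:~R *: alpha + int_rV R m].

(* The sum over Z^d is a finitely supported sum, which is the intended value
   whenever S is bounded (only finitely many terms are then nonzero). *)
Definition chi (R : realType) (d : nat) (S : set 'rV[R]_d) (x : 'rV[R]_d) : R :=
  \sum_(k \in [set: 'rV[int]_d]) (\1_S (x + int_rV R k) : R).

(* chi S being Z^d-periodic, "for almost every x in T^d" is "for almost every
   x in R^d": a subset of T^d is null iff its preimage in R^d is. *)
Definition is_BRS (R : realType) (d : nat) (alpha : 'rV[R]_d)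
    (S : set 'rV[R]_d) :=
  [/\ bounded_set S, lebesgue_measurable S &
    exists C : R, forall n : nat, (0 < n)%N ->
      {ae mes R d, forall x : 'rV[R]_d,
        `|\sum_(k < n) chi S (x + k%:R *: alpha) - n%:R * fine (mes R d S)|
          <= C}].

Definition parallelepiped (R : realType) (d : nat) (v : 'I_d -> 'rV[R]_d) :
    set 'rV[R]_d :=
  [set x | exists2 t : 'I_d -> R,
    forall k, 0 <= t k < 1 & x = \sum_(k < d) t k *: v k].

Definition is_parallelepiped_spanned_by (R : realType) (d : nat)
    (P : set 'rV[R]_d) (v : 'I_d -> 'rV[R]_d) :=
  row_free (\matrix_(k < d) v k) /\ P = parallelepiped v.

(* Main.v *)
Require Import Defs.
From HB Require Import structures.
From mathcomp Require Import all_boot all_order all_algebra.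
From mathcomp Require Import all_classical all_reals all_analysis.
From mathcomp Require Import measurable_realfun.
From mathcomp Require Import ring lra zify.
Import Order.TTheory GRing.Theory Num.Theory.
Import numFieldNormedType.Exports.
Set Implicit Arguments.
Unset Strict Implicit.
Unset Printing Implicit Defensive.
Local Open Scope classical_set_scope.
Local Open Scope ring_scope.

(** The visits of the orbit of [x] to a set [S] are the pairs [(k, m)] of
    Z x Z^d with [0 <= k < n] and [x + k alpha + m] in [S], so everything takes
    place in the lattice Z^(1+d), mapped to R^d by the projection
    [(k, m) |-> k alpha + m] along the vector [(1, -alpha)].

    The number [gamma] is the value on [(1, -alpha)] of the integral linear
    form with coefficients [N = (n0, -n)].  The Smith normal form writes [N] as
    [g h] with [g > 0] and [h] the first column of a unimodular [U]
    ([unimodular_of_column]).  The last [d] rows of [U^-1] form a basis of the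
    integral points of the hyperplane [h = 0].  Because [h] does not vanish on
    [(1, -alpha)], their projections are linearly independent in R^d
    ([row_free_basis]); they belong to Z alpha + Z^d, and the parallelepiped
    [P] is spanned by them after one has been multiplied by [g].

    [P] is a fundamental domain for the lattice that its edges span, so each
    coset of the corresponding index-[g] sublattice of [h = 0] in Z^(1+d)
    contains exactly one [(k, m)] with [x + k alpha + m] in [P].  These cosets
    are numbered by the integers, [g] of them on each level [h = c].  On the
    level [h = c] a point of [P] is reached at a time [k] with
    [k h(1, -alpha) = c + O(1)], uniformly, because [P] is bounded.  Hence the
    visits are numbered by an integer [b = k gamma + O(1)], and the number of
    visits with [0 <= k < n] is [n gamma + O(1)], uniformly in [x] and [n]
    ([discrepancy_of_enumeration], [parallelepiped_discrepancy]).

    The volume of [P] follows from this count: by translation invariance the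
    number of visits up to time [n] has integral [n mes P] over the unit cube,
    so [n mes P = n gamma + O(1)] for all [n], and [mes P = gamma]
    ([bounded_discrepancy_measure]). *)

(** * Counting the visits of an orbit *)

Lemma chi_size (R : realType) (d : nat) (S : set 'rV[R]_d) (x : 'rV[R]_d)
    (s : seq 'rV[int]_d) :
  uniq s -> (forall m, (m \in s) <-> S (x + int_rV R m)) ->
  chi S x = (size s)%:R.
Proof.
move=> us sS; rewrite /chi (@fsbigE _ _ _ _ _ s) //; last first.
  by move=> m _ /negP ms; rewrite indicE memNset// => /sS.
rewrite big_seq_cond (eq_bigr (fun=> 1)); last first.
  by move=> m /andP[/sS Sm _]; rewrite indicE mem_set.
rewrite -big_seq_cond (eq_bigl predT) => [|m]; last by rewrite in_setT.
by rewrite big_const_seq count_predT iter_addr addr0.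
Qed.

(** The [b]-th visit takes place at a time [k b] with [k b * gamma] within [B]
    of [b - a].  The numbers [b] of the visits at times in [[0, n)] therefore
    lie between [a - B] and [a + n gamma + B], and every [b] between [a + B]
    and [a + n gamma - B] occurs. *)
Lemma discrepancy_of_enumeration (R : realType) (d : nat) (alpha x : 'rV[R]_d)
    (S : set 'rV[R]_d) (gamma a B : R) (k : int -> int)
    (m : int -> 'rV[int]_d) :
    0 < gamma ->
    (forall b, S (x + (k b)%:~R *: alpha + int_rV R (m b))) ->
    (forall (i : nat) l, S (x + i%:R *: alpha + int_rV R l) ->
      exists2 b, k b = i & m b = l) ->
    (forall b b', k b = k b' -> m b = m b' -> b = b') ->
    (forall b, `|b%:~R - a - (k b)%:~R * gamma| <= B) ->
  forall n : nat,
  `|\sum_(i < n) chi S (x + i%:R *: alpha) - n%:R * gamma| <= 2 * B + 3.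
Proof.
move=> gamma_gt0 kmS Skm km_inj kB n.
have B_ge0 : 0 <= B by apply: le_trans (kB 0).
pose lo := Num.floor (a - B).
have ngamma : 0 <= n%:R * gamma by rewrite mulr_ge0// ltW.
(* The window lo, ..., lo + L - 1 contains the number of each visit at a time
   in [0, n). *)
have [L LE] : exists L, L = (Num.trunc (n%:R * gamma + 2 * B)).+2 by eexists.
have chiE (i : 'I_n) : chi S (x + i%:R *: alpha) =
    (count (fun j : nat => k (lo + j%:Z) == i%:Z) (iota 0 L))%:R.
  pose s := [seq m (lo + j%:Z) | j : nat <- iota 0 L & k (lo + j%:Z) == i%:Z].
  rewrite (@chi_size _ _ _ _ s) ?size_map ?size_filter//.
    rewrite map_inj_in_uniq ?filter_uniq ?iota_uniq// => j j'.
    rewrite !mem_filter => /andP[/eqP kj _] /andP[/eqP kj' _] mj.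
    by have := km_inj _ _ (etrans kj (esym kj')) mj; lia.
  move=> l; split.
    case/mapP => j; rewrite mem_filter => /andP[/eqP kj _] ->.
    by have := kmS (lo + j%:Z); rewrite kj.
  case/Skm => b kb mb; have := kB b; rewrite kb ler_norml => /andP[bl bu].
  have lob : lo <= b.
    rewrite -(ler_int R); apply: le_trans (floor_le _) _.
    have : 0 <= i%:R * gamma by rewrite mulr_ge0// ltW.
    rewrite -pmulrn in bl *; lra.
  have bL : b < lo + L%:Z.
    rewrite -(ltr_int R) rmorphD/=.
    have := floorD1_gt (a - B); rewrite -/lo rmorphD/=.
    have := truncnS_gt (n%:R * gamma + 2 * B).
    have : i%:R * gamma <= n%:R * gamma.
      by rewrite ler_wpM2r ?(ltW gamma_gt0)// ler_nat ltnW.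
    rewrite -pmulrn in bu *; rewrite -pmulrn LE.
    rewrite -[in X in _ -> _ -> _ -> X]natr1; lra.
  have lobE : lo + `|b - lo|%N%:Z = b by lia.
  apply/mapP; exists `|b - lo|%N; rewrite ?lobE//.
  by rewrite mem_filter lobE kb eqxx mem_iota/=; lia.
pose good (j : nat) := (0 <= k (lo + j%:Z) < n%:Z)%R.
have -> : \sum_(i < n) chi S (x + i%:R *: alpha) = (count good (iota 0 L))%:R.
  rewrite (eq_bigr _ (fun i _ => chiE i)) -natr_sum; congr (_%:R).
  under eq_bigr do rewrite -sumn_count sumnE big_map.
  rewrite exchange_big/= -sumn_count sumnE big_map; apply: eq_bigr => j _.
  rewrite /good; case: (k _) => [p|p] /=; last by rewrite big1.
  case: (ltnP p n) => pn.
    rewrite (bigD1 (Ordinal pn))//= eqxx big1 ?addn0 ?ltz_nat ?pn// => i ip.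
    apply/eqP; rewrite eqb0; apply: contra ip => /eqP[pi].
    exact/eqP/val_inj.
  rewrite ltz_nat ltnNge pn big1// => i _.
  by apply/eqP; rewrite eqb0; apply/eqP => -[pi]; have := ltn_ord i; lia.
have upper : (count good (iota 0 L))%:R <= n%:R * gamma + 2 * B + 2 :> R.
  apply: (@le_trans _ _ L%:R).
    by rewrite ler_nat (leq_trans (count_size _ _))// size_iota.
  have : 0 <= n%:R * gamma + 2 * B by rewrite addr_ge0// mulr_ge0.
  rewrite -truncn_le LE -!natr1; lra.
have lower : n%:R * gamma - 2 * B - 3 <= (count good (iota 0 L))%:R :> R.
  (* All positions j of the window with J1 <= j < J2 are visits at a time in
     [0, n). *)
  pose J1 := (Num.trunc (2 * B + 1)).+1.
  pose J2 := Num.trunc (n%:R * gamma).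
  have J1_gt : 2 * B + 1 < J1%:R by exact: truncnS_gt.
  have J1_le : J1%:R <= 2 * B + 2.
    have : 0 <= 2 * B + 1 by lra.
    rewrite -truncn_le /J1 -natr1; lra.
  have J2_le : J2%:R <= n%:R * gamma by rewrite truncn_le.
  have J2_gt : n%:R * gamma < J2%:R + 1 by rewrite natr1; exact: truncnS_gt.
  apply: (@le_trans _ _ (J2 - J1)%:R).
    have : J2%:R <= (J2 - J1)%:R + J1%:R :> R by rewrite -natrD ler_nat; lia.
    lra.
  rewrite ler_nat -[(J2 - J1)%N](size_iota J1) -size_filter.
  apply: uniq_leq_size; first exact: iota_uniq.
  move=> j; rewrite mem_iota mem_filter mem_iota/= => /andP[J1j jJ2].
  have {}jJ2 : j%:R + 1 <= J2%:R :> R by rewrite natr1 ler_nat; lia.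
  have {}J1j : J1%:R <= j%:R :> R by rewrite ler_nat.
  have := kB (lo + j%:Z); rewrite ler_norml rmorphD/= -pmulrn => /andP[bl bu].
  have loU := floor_le (a - B); have loL := floorD1_gt (a - B).
  rewrite -/lo rmorphD/= in loU loL.
  apply/andP; split; last first.
    rewrite add0n -(ltr_nat R) LE -[(Num.trunc _).+2]addn2 natrD.
    have := truncnS_gt (n%:R * gamma + 2 * B).
    by rewrite -[(Num.trunc _).+1]addn1 natrD; lra.
  rewrite /good; apply/andP; split.
    by rewrite -(ler0z R) -(pmulr_lge0 _ gamma_gt0); lra.
  by rewrite -(ltr_int R) -(ltr_pM2r gamma_gt0) -pmulrn; lra.
by rewrite ler_norml; lra.
Qed.

(** * Translations and the integral of the periodization *)

Lemma lebesgue_measure_shift (R : realType) (c : R)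
    (A : set (measurableTypeR R)) :
  measurable A ->
  lebesgue_measure ((fun x => x + c) @^-1` A) = lebesgue_measure A.
Proof.
have ms : measurable_fun [set: measurableTypeR R]
    ((fun x => x + c) : measurableTypeR R -> measurableTypeR R).
  by apply: measurable_funD.
move=> mA; rewrite -[LHS]/(pushforward lebesgue_measure
  ((fun x => x + c) : measurableTypeR R -> measurableTypeR R) A).
apply/esym/lebesgue_measure_unique => //=.
move=> _ [[a b]] _ <-.
rewrite /pushforward (_ : _ @^-1` _ = `]a - c, b - c]%classic); last first.
  by apply/seteqP; split=> x; rewrite /= !in_itv/= ltrBlDr lerBrDr.
rewrite !lebesgue_measure_itv/= !lte_fin ltrBlDr subrK.
by case: ifP => // _; rewrite -!EFinB; congr (_%:E); lra.
Qed.

Lemma measurable_rV_shift (R : realType) (n : nat) (c : 'rV[R]_n) :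
  measurable_fun [set: 'rV[R]_n] (fun x => x + c).
Proof.
apply: measurable_fun_rVP => i.
rewrite (_ : _ \o _ = fun x => rV_coord i x + c ord0 i).
  by apply: measurable_funD => //; exact: measurable_rV_coord.
by apply/funext => x; rewrite /= /rV_coord mxE.
Qed.

Lemma measurable_preimage_shift (R : realType) (n : nat) (c : 'rV[R]_n)
    (T : set 'rV[R]_n) :
  measurable T -> measurable ((fun x => x + c) @^-1` T).
Proof.
by move=> mT; rewrite -[X in measurable X]setTI; exact: measurable_rV_shift.
Qed.

(** Both sides are measures that agree on the boxes [B `*` D], by the
    one-dimensional case and the induction hypothesis. *)
Lemma lebesgue_rV_shift (R : realType) (n : nat) (c : 'rV[R]_n)
    (A : set 'rV[R]_n) : measurable A ->
  lebesgue_rV R n ((fun x => x + c) @^-1` A) = lebesgue_rV R n A.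
Proof.
elim: n => [|n IHn] in c A *.
  move=> _; congr (lebesgue_rV R 0 _).
  by apply/funext => x /=; rewrite [x + c]thinmx0 [x in RHS]thinmx0.
move=> mA /=; rewrite /lebesgue_rV_step /pushforward.
pose c' : 'rV[R]_n := \row_i c ord0 (lift ord0 i).
pose s (p : measurableTypeR R * 'rV[R]_n) : measurableTypeR R * 'rV[R]_n :=
  (p.1 + c ord0 ord0, p.2 + c').
have ms : measurable_fun setT s.
  apply: measurable_fun_pair; first exact: measurable_funD.
  exact: (measurableT_comp (measurable_rV_shift c') measurable_snd).
have -> : (@rV_cons R n) @^-1` ((fun x => x + c) @^-1` A) =
    s @^-1` ((@rV_cons R n) @^-1` A).
  apply/funext => p /=; congr (A _); apply/rowP => i; rewrite !mxE.
  by have [j ->|->] := unliftP ord0 i; rewrite ?mxE.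
have mcA : measurable (@rV_cons R n @^-1` A).
  by rewrite -[X in measurable X]setTI; exact: measurable_rV_cons.
symmetry.
rewrite -[RHS]/(pushforward (lebesgue_measure \x lebesgue_rV R n)%E s _).
apply: product_measure_unique => //.
move=> B D mB mD; rewrite /= /pushforward.
rewrite (_ : _ @^-1` _ = ((fun x => x + c ord0 ord0) @^-1` B) `*`
  ((fun x => x + c') @^-1` D))//.
rewrite product_measure1E ?IHn//.
- by congr (_ * _)%E; exact: lebesgue_measure_shift.
- by rewrite -[X in measurable X]setTI; exact: measurable_funD.
- exact: measurable_preimage_shift.
Qed.

Lemma measurable_cell (R : realType) d (T : measurableType d) (m : nat)
    (f : 'I_m -> T -> R) : (forall i, measurable_fun setT (f i)) ->
  measurable [set x | forall i, 0 <= f i x < 1].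
Proof.
move=> mf; rewrite (_ : mkset _ =
    \bigcap_(i in [set: 'I_m]) (f i @^-1` `[0, 1[%classic)); last first.
  apply/seteqP; split=> x fx i; first by move=> _; rewrite /= in_itv/= fx.
  by have := fx i I; rewrite /= in_itv/=.
apply: fin_bigcap_measurable => // i _.
by rewrite -[X in measurable X]setTI; exact: mf.
Qed.

Definition unit_cube (R : realType) (n : nat) : set 'rV[R]_n :=
  [set x | forall i, 0 <= x ord0 i < 1].

Lemma measurable_unit_cube (R : realType) (n : nat) :
  measurable (@unit_cube R n).
Proof. by apply: measurable_cell => i; exact: measurable_rV_coord. Qed.

Lemma lebesgue_rV_unit_cube (R : realType) (n : nat) :
  lebesgue_rV R n (@unit_cube R n) = 1%E.
Proof.
elim: n => [|n IHn].
  by rewrite /= diracE mem_set// => -[].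
rewrite /= /lebesgue_rV_step /pushforward.
rewrite (_ : _ @^-1` _ = `[0, 1[%classic `*` @unit_cube R n); last first.
  apply/seteqP; split => [[a v]|[a v] [a01 v01]].
    move=> av; split => /=.
      by have := av ord0; rewrite mxE unlift_none in_itv.
    by move=> i; have := av (lift ord0 i); rewrite mxE liftK.
  by move=> i; rewrite mxE; case: unliftP => [j|] _ /=.
rewrite product_measure1E ?IHn//; last exact: measurable_unit_cube.
rewrite mule1; apply: (etrans (lebesgue_measure_itv `[0%R, 1%R[)).
by rewrite /= lte_fin ltr01 oppr0 adde0.
Qed.

Lemma finite_int_box (n K : nat) :
  finite_set [set m : 'rV[int]_n | forall i, `|m ord0 i| <= K%:Z].
Proof.
apply: (@sub_finite_set _ _ ((fun f : {ffun 'I_n -> 'I_(K + K).+1} =>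
  \row_i ((f i)%:Z - K%:Z)) @` setT)); last exact/finite_image/finite_finset.
move=> m mK; exists [ffun i => inord `|(m ord0 i + K%:Z)%R|%N] => //.
apply/rowP => i; have := mK i; rewrite ler_norml => /andP[mL mU].
rewrite mxE ffunE; change (m 0 i) with (m ord0 i).
by move: (m ord0 i) mL mU => z mL mU; rewrite inordK; lia.
Qed.

(** Over the unit cube the translates of a bounded set that matter are finitely
    many, the same ones for all points: the sum becomes a fixed finite one,
    which gives the measurability and the integral below. *)
Lemma chi_unit_cube (R : realType) (n : nat) (T : set 'rV[R]_n) (K : nat) :
  (forall x, T x -> forall i, `|x ord0 i| <= K%:R) ->
  {in @unit_cube R n, chi T =1 fun x =>
    \sum_(m \in [set m : 'rV[int]_n | forall i, `|m ord0 i| <= (K + 1)%:Z])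
      (\1_((fun x : 'rV[R]_n => x + int_rV R m) @^-1` T) x : R)}.
Proof.
move=> TK x /set_mem xQ; rewrite /chi; symmetry.
apply: fsbig_widen => // m [_ mB] /=; rewrite indicE memNset//.
move=> Txm; apply: mB => i.
have := TK _ Txm i; rewrite !mxE -(ler_int R) intr_norm.
have := xQ i; rewrite !ler_norml -pmulrn natrD => /andP[? ?] /andP[? ?].
lra.
Qed.

Lemma measurable_chi (R : realType) (n : nat) (T : set 'rV[R]_n) (K : nat) :
  measurable T -> (forall x, T x -> forall i, `|x ord0 i| <= K%:R) ->
  measurable_fun (@unit_cube R n) (chi T).
Proof.
move=> mT TK; apply: eq_measurable_fun.
  by move=> x xQ; rewrite (chi_unit_cube TK xQ).
rewrite (_ : (fun x => _) = fun x : 'rV[R]_n =>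
  \sum_(m <- finmap.enum_fset (fset_set
    [set m : 'rV[int]_n | forall i, `|m ord0 i| <= (K + 1)%:Z]))
  (\1_((fun x : 'rV[R]_n => x + int_rV R m) @^-1` T) x : R)).
  apply: measurable_sum => m; apply: measurable_indic.
  exact: measurable_preimage_shift.
by apply/funext => x; rewrite fsbig_finite//; exact: finite_int_box.
Qed.

(** Unfolding: the integral over the cube of the periodization is the sum of
    the measures of the pieces of [T] in the cubes [m + [0, 1)^n], which
    partition the space. *)
Lemma integral_chi (R : realType) (n : nat) (T : set 'rV[R]_n) (K : nat) :
  measurable T -> (forall x, T x -> forall i, `|x ord0 i| <= K%:R) ->
  (\int[lebesgue_rV R n]_(x in @unit_cube R n) (chi T x)%:E)%E =
  lebesgue_rV R n T.
Proof.
move=> mT TK.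
pose B := [set m : 'rV[int]_n | forall i, `|m ord0 i| <= (K + 1)%:Z].
have finB : finite_set B by exact: finite_int_box.
have mS m : measurable ((fun x : 'rV[R]_n => x + int_rV R m) @^-1` T).
  exact: measurable_preimage_shift.
transitivity (\int[lebesgue_rV R n]_(x in @unit_cube R n)
    (\sum_(m \in B) (\1_((fun x => x + int_rV R m) @^-1` T) x : R)%:E))%E.
  by apply: eq_integral => x xQ; rewrite (chi_unit_cube TK xQ) fsumEFin.
rewrite ge0_integral_fsum//; last first.
- by move=> m; apply/measurable_EFinP; exact: measurable_indic.
- exact: measurable_unit_cube.
under eq_fsbigr => m _.
  rewrite integral_indic//; last exact: measurable_unit_cube.
  over.
have mQ m :
    measurable ((fun x : 'rV[R]_n => x - int_rV R m) @^-1` @unit_cube R n).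
  by apply: measurable_preimage_shift; exact: measurable_unit_cube.
transitivity (\sum_(m \in B) lebesgue_rV R n
    (T `&` (fun x : 'rV[R]_n => x - int_rV R m) @^-1` @unit_cube R n)).
  apply: eq_fsbigr => m _; rewrite -[RHS](lebesgue_rV_shift (int_rV R m)).
    by congr (lebesgue_rV R n _); apply/seteqP; split => x /=; rewrite addrK.
  exact: measurableI.
rewrite -measure_fin_bigcup//.
- congr (lebesgue_rV R n _); apply/seteqP; split => [x [m _ []]//|x Tx].
  exists (\row_i Num.floor (x ord0 i)); last first.
    split=> // i; rewrite !mxE; have := floor_itv (x ord0 i).
    by rewrite rmorphD/= => /andP[? ?]; lra.
  move=> i; rewrite mxE.
  have := TK _ Tx i; rewrite !ler_norml => /andP[xL xU].
  rewrite floor_ge_int -ltzD1 floor_lt_int !rmorphD/= rmorphN/=.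
  by rewrite rmorphD/= -!pmulrn; lra.
- move=> m m' _ _ [x [[_ xm] [_ xm']]]; apply/rowP => i.
  have := xm i; have := xm' i; rewrite !mxE => xm'01 xm01.
  transitivity (Num.floor (x ord0 i)).
    by apply/esym/floor_def; rewrite rmorphD/=; lra.
  by apply/floor_def; rewrite rmorphD/=; lra.
- by move=> m _; exact: measurableI.
Qed.

(** * Integral forms and the projection along the flow *)

(** Equivalently, an integral linear form is a positive multiple of a form that
    belongs to a basis of the dual lattice.  The Smith normal form gives a
    multiple of either sign, and the sign is moved into [U]. *)
Lemma unimodular_of_column (n : nat) (N : 'cV[int]_n.+1) : N != 0 ->
  exists (U : 'M[int]_n.+1) (g : nat),
    [/\ U \in unitmx, (0 < g)%N & N = g%:Z *: col ord0 U].
Proof.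
move=> N0.
have [L uL [r ur [s _ NE]]] := int_Smith_normal_form N.
pose c := s`_0 * r ord0 ord0.
have {}NE : N = c *: col ord0 L.
  apply/colP => i; rewrite NE !mxE big_ord1 !mxE (bigD1 ord0)//= big1 ?addr0.
    by rewrite !mxE mulr1n /c -mulrA mulrC.
  move=> j j0; rewrite mxE [X in _ *+ X](_ : _ = 0%N) ?mulr0//.
  by case: j j0 => -[].
have c0 : c != 0 by apply: contraNneq N0 => c0; rewrite NE c0 scale0r.
exists (Num.sg c *: L), `|c|%N; split.
- have sgu : Num.sg c \is a GRing.unit by case: sgzP c0.
  by rewrite unitmxZ.
- by rewrite absz_gt0.
- by rewrite NE linearZ/= scalerA abszE mulrC -numEsg.
Qed.

(** On rows this is the projection of R^(1+d) onto R^d along [(1, -alpha)]; it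
    maps [(k, m)] to [k alpha + m], hence Z^(1+d) onto Z alpha + Z^d. *)
Definition flow_proj (R : realType) (d : nat) (alpha : 'rV[R]_d) :
  'M[R]_(1 + d, d) := col_mx alpha 1%:M.

(** The value of the linear form [h] on [(1, -alpha)].  A line in this direction
    meets the levels [h = c], for integral [c], with this frequency. *)
Definition crossing_rate (R : realType) (d : nat) (alpha : 'rV[R]_d)
    (h : 'cV[R]_(1 + d)) :=
  (row_mx 1%:M (- alpha) *m h) ord0 ord0.

Lemma flow_projE (R : realType) (d : nat) (alpha : 'rV[R]_d) (k : 'M[R]_1)
  (m : 'rV[R]_d) : row_mx k m *m flow_proj alpha = k ord0 ord0 *: alpha + m.
Proof. by rewrite mul_row_col mulmx1 [k in LHS]mx11_scalar mul_scalar_mx. Qed.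

(** [(k, m)] and its projection [(0, k alpha + m)] differ by [k (1, -alpha)],
    and the restriction of [h] to the last [d] coordinates is [dsubmx h]. *)
Lemma flow_proj_height (R : realType) (d : nat) (alpha : 'rV[R]_d)
    (k : 'M[R]_1) (m : 'rV[R]_d) (h : 'cV[R]_(1 + d)) :
  ((k ord0 ord0 *: alpha + m) *m dsubmx h) ord0 ord0 =
  (row_mx k m *m h) ord0 ord0 - k ord0 ord0 * crossing_rate alpha h.
Proof.
rewrite /crossing_rate -[h in RHS]vsubmxK !mul_row_col mul1mx.
have -> : k *m usubmx h = k ord0 ord0 *: usubmx h.
  by rewrite {1}(mx11_scalar k) mul_scalar_mx.
rewrite mulmxDl mulNmx -scalemxAl.
move: (alpha *m _) (m *m _) (usubmx h) => X Y Z; rewrite !mxE.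
ring.
Qed.

Lemma Zspan_flow_proj (R : realType) (d : nat) (alpha : 'rV[R]_d)
    (z : 'rV[int]_(1 + d)) : Zspan alpha (map_mx intr z *m flow_proj alpha).
Proof.
exists (lsubmx z ord0 ord0), (rsubmx z).
by rewrite -[in LHS](hsubmxK z) map_row_mx flow_projE mxE.
Qed.

(** The rows of [dsubmx V] span the hyperplane on which the first column of [U]
    vanishes.  The kernel of the projection is the line through
    [(1, -alpha)], which meets this hyperplane only at 0 when the rate is
    nonzero. *)
Lemma row_free_basis (R : realType) (d : nat) (alpha : 'rV[R]_d)
    (U V : 'M[R]_(1 + d)) : V *m U = 1%:M ->
  crossing_rate alpha (col ord0 U) != 0 ->
  row_free (dsubmx V *m flow_proj alpha).
Proof.
move=> VU rate0; apply: inj_row_free => e; rewrite mulmxA => ep0.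
set r := e *m _ in ep0.
have rE : r = row_mx 0 e *m V.
  by rewrite -[V in RHS](@vsubmxK _ 1) mul_row_col mul0mx add0r.
have rU : r *m U = row_mx 0 e by rewrite rE -mulmxA VU mulmx1.
have rh : (r *m col ord0 U) ord0 ord0 = 0.
  rewrite colE mulmxA rU -colE mxE.
  transitivity ((row_mx (0 : 'M[R]_1) e) ord0 (lshift d ord0)).
    by congr (row_mx _ _ _ _); exact: val_inj.
  by rewrite row_mxEl mxE.
move: ep0 rh; rewrite -[r]hsubmxK => ep0 rh.
have := flow_proj_height alpha (lsubmx r) (rsubmx r) (col ord0 U).
rewrite -flow_projE ep0 mul0mx mxE rh sub0r => /esym/eqP.
rewrite oppr_eq0 mulf_eq0 (negbTE rate0) orbF => /eqP k0.
have l0 : lsubmx r = 0 by apply/rowP => i; rewrite ord1 k0 mxE.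
move: ep0; rewrite flow_projE k0 scale0r add0r => r0.
move: rU; rewrite -[r]hsubmxK l0 r0 row_mx0 mul0mx => /esym.
by rewrite -row_mx0 => /eq_row_mx[].
Qed.

(** * Parallelepipeds *)

Lemma row_free_scale_rows (R : realType) (d : nat) (A : 'M[R]_d)
    (s : 'I_d -> R) : row_free A -> (forall i, 0 < s i) ->
  row_free (\matrix_k (s k *: row k A)).
Proof.
move=> fA s0; apply: inj_row_free => e es.
have : (\row_k (e ord0 k * s k)) *m A = 0 *m A.
  rewrite mul0mx -es !mulmx_sum_row; apply: eq_bigr => k _.
  by rewrite mxE rowK scalerA.
move/(row_free_inj fA)/rowP => es0; apply/rowP => k; have := es0 k.
by rewrite !mxE => /eqP; rewrite mulf_eq0 (gt_eqF (s0 k)) orbF => /eqP.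
Qed.

(** Membership is tested in the coordinates of the unscaled edges [row i A]: in
    these, the translations by projected lattice points of level 0 are exactly
    the integral ones. *)
Lemma scaled_parallelepipedP (R : realType) (d : nat) (A : 'M[R]_d)
    (s : 'I_d -> R) (t : 'rV[R]_d) :
  row_free A -> (forall i, 0 < s i) ->
  parallelepiped (fun i => s i *: row i A) (t *m A) <->
  forall i, 0 <= t ord0 i < s i.
Proof.
move=> fA s0; split=> [[u u01]|ts].
  have -> : \sum_(k < d) u k *: (s k *: row k A) = (\row_k (u k * s k)) *m A.
    by rewrite mulmx_sum_row; apply: eq_bigr => k _; rewrite mxE scalerA.
  move/(row_free_inj fA) => -> i; rewrite mxE.
  have /andP[u0 u1] := u01 i.
  by rewrite mulr_ge0 ?(ltW (s0 _))//= -[ltRHS]mul1r ltr_pM2r.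
exists (fun i => t ord0 i / s i) => [i|].
  have /andP[t0 t1] := ts i.
  by rewrite divr_ge0 ?(ltW (s0 _))//= ltr_pdivrMr ?mul1r.
rewrite mulmx_sum_row; apply: eq_bigr => k _; rewrite scalerA divfK//.
by rewrite gt_eqF.
Qed.

Lemma parallelepiped_coord_le (R : realType) (d : nat) (v : 'I_d -> 'rV[R]_d) :
  exists K : nat, forall x, parallelepiped v x ->
    forall i, `|x ord0 i| <= K%:R.
Proof.
pose M := \sum_(k < d) \sum_(i < d) `|v k ord0 i|.
exists (Num.trunc M).+1 => _ [t t01 ->] i.
apply: le_trans (ltW (truncnS_gt M)).
rewrite summxE; apply: le_trans (ler_norm_sum _ _ _) _.
apply: ler_sum => k _; rewrite (bigD1 i)//= mxE normrM.
have /andP[t0 t1] := t01 k.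
apply: (@le_trans _ _ `|v k ord0 i|); last by rewrite lerDl sumr_ge0.
by rewrite ler_piMl// ger0_norm// ltW.
Qed.

Lemma measurable_parallelepiped (R : realType) (d : nat)
    (v : 'I_d -> 'rV[R]_d) :
  row_free (\matrix_k v k) -> measurable (parallelepiped v).
Proof.
move=> fv; set A := \matrix_k v k in fv.
have uA : A \in unitmx by rewrite -row_free_unit.
rewrite (_ : parallelepiped v =
    [set x | forall i, 0 <= (x *m invmx A) ord0 i < 1]).
  apply: measurable_cell => i.
  rewrite (_ : (fun _ => _) =
      fun x : 'rV[R]_d => \sum_j rV_coord j x * invmx A j i).
    apply: measurable_sum => j; apply: measurable_funM => //.
    exact: measurable_rV_coord.
  by apply/funext => x; rewrite mxE.
apply/funext => x; apply/propext.
have := @scaled_parallelepipedP _ _ A (fun=> 1) (x *m invmx A) fv (fun=> ltr01).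
rewrite mulmxKV// (_ : (fun i => _) = v)//.
by apply/funext => i; rewrite scale1r rowK.
Qed.

Lemma bounded_set_coord (R : realType) (d : nat) (S : set 'rV[R]_d) (K : nat) :
  (forall x, S x -> forall i, `|x ord0 i| <= K%:R) -> bounded_set S.
Proof.
move=> SK; exists K%:R; split=> [//|M KM x Sx].
rewrite /= /Num.norm/= mx_normrE.
apply/bigmax_leP; split=> [|[i j] _]; first exact/ltW/(le_lt_trans _ KM).
by rewrite ord1; apply: le_trans (SK _ Sx _) (ltW KM).
Qed.

Lemma floor_shift_lt (R : realType) (t : R) (e : int) (g : nat) :
  0 <= t + e%:~R < g%:R <-> 0 <= Num.floor t + e < g%:Z.
Proof.
have -> : Num.floor t + e = Num.floor (t + e%:~R).
  by rewrite floorDrz ?intrKfloor.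
by rewrite floor_ge0 floor_lt_int -pmulrn.
Qed.

(** * Bounded discrepancy of the parallelepiped *)

(** In the coordinates given by [U], a lattice point is [row_mx c f *m V], with
    [c] its level.  Given [c], membership of [x + k alpha + m] in [P] fixes
    every coordinate of [f] as the opposite of a floor, except the one along
    the edge multiplied by [g], which can take [g] consecutive values.  So [c] and the
    position [j < g] among these values determine the visit, and the integer
    [b = c g + j] numbers the visits. *)
Lemma parallelepiped_discrepancy (R : realType) (d : nat) (alpha : 'rV[R]_d)
    (U V : 'M[int]_(1 + d)) (i0 : 'I_d) (g : nat) :
  U *m V = 1%:M -> V *m U = 1%:M -> (0 < g)%N ->
  let rate := crossing_rate alpha (map_mx intr (col ord0 U)) in
  let A := dsubmx (map_mx intr V : 'M[R]_(1 + d)) *m flow_proj alpha in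
  let P := parallelepiped
    (fun i => (if i == i0 then g else 1)%:R *: row i A) in
  0 < rate ->
  exists C : R, forall (x : 'rV[R]_d) (n : nat),
    `|\sum_(k < n) chi P (x + k%:R *: alpha) - n%:R * (g%:R * rate)| <= C.
Proof.
move=> UV VU g0 rate A P rate0.
have VUR : map_mx intr V *m map_mx intr U = 1%:M :> 'M[R]_(1 + d).
  by rewrite -map_mxM VU map_mx1.
have fA : row_free A.
  by apply: (row_free_basis VUR); rewrite -map_col gt_eqF.
have uA : A \in unitmx by rewrite -row_free_unit.
have s0 (i : 'I_d) : 0 < (if i == i0 then g else 1)%:R :> R.
  by rewrite ltr0n; case: ifP.
have PE := scaled_parallelepipedP _ fA s0; rewrite -/P in PE.
have [K PK] := parallelepiped_coord_le
  (fun i => (if i == i0 then g else 1)%:R *: row i A).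
pose h : 'cV[R]_d := dsubmx (map_mx intr (col ord0 U)).
pose B := g%:R + g%:R * \sum_i K%:R * `|h i ord0|.
exists (2 * B + 3) => x n.
pose beta := usubmx (map_mx intr V : 'M[R]_(1 + d)) *m flow_proj alpha.
pose fl (c : int) i := Num.floor (((x + c%:~R *: beta) *m invmx A) ord0 i).
pose e (b : int) : 'rV[int]_d :=
  \row_i ((if i == i0 then (b %% g)%Z else 0) - fl (b %/ g)%Z i).
pose z (b : int) : 'rV[int]_(1 + d) := row_mx (b %/ g)%Z%:M (e b) *m V.
have pointE c (f : 'rV[int]_d) :
    x + map_mx intr (row_mx c%:M f *m V : 'rV_(1 + d)) *m flow_proj alpha =
    ((x + c%:~R *: beta) *m invmx A + map_mx intr f) *m A.
  rewrite mulmxDl mulmxKV// map_mxM -mulmxA -addrA; congr (_ + _).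
  rewrite map_row_mx -[map_mx intr V](@vsubmxK _ 1) mul_col_mx mul_row_col.
  by rewrite map_scalar_mx mul_scalar_mx.
have splitE (w : 'rV[int]_(1 + d)) :
    map_mx intr w *m flow_proj alpha =
    (lsubmx w ord0 ord0)%:~R *: alpha + int_rV R (rsubmx w).
  by rewrite -[in LHS](hsubmxK w) map_row_mx flow_projE mxE.
have inP c f :
    P (x + map_mx intr (row_mx c%:M f *m V : 'rV_(1 + d)) *m flow_proj alpha) <->
    forall i, 0 <= fl c i + f ord0 i < (if i == i0 then g else 1)%N%:Z.
  rewrite pointE; split.
    move/PE => cf i; apply/floor_shift_lt; have := cf i.
    by rewrite [(_ + _ : 'rV__) _ _]mxE [map_mx _ _ _ _]mxE.
  move=> cf; apply/PE => i.
  rewrite [(_ + _ : 'rV__) _ _]mxE [map_mx _ _ _ _]mxE.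
  exact/floor_shift_lt/cf.
have g0' : g%:Z != 0 by rewrite eqz_nat -lt0n.
have coordsK c f : row_mx c%:M f *m V *m U = row_mx c%:M f :> 'rV_(1 + d).
  by rewrite -mulmxA VU mulmx1.
have row_mx_inj c f c' f' :
    row_mx c%:M f = row_mx c'%:M f' :> 'rV[int]_(1 + d) -> c = c' /\ f = f'.
  by move/eq_row_mx => [/matrixP/(_ ord0 ord0)]; rewrite !mxE eqxx !mulr1n.
have inPz b : P (x + map_mx intr (z b) *m flow_proj alpha).
  apply/inP => i; rewrite mxE addrCA subrr addr0; case: ifP => // _.
  by rewrite modz_ge0//= ltz_pmod.
(* With y in P the point reached by visit b, the height formula gives
   b - k (g rate) = j + g (y.h) - g (x.h), where j < g and y.h is bounded. *)
apply: (@discrepancy_of_enumeration _ _ _ _ _ _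
  (- (g%:R * (x *m h) ord0 ord0)) B
  (fun b => lsubmx (z b) ord0 ord0) (fun b => rsubmx (z b))).
- by rewrite mulr_gt0// ltr0n.
- move=> b; rewrite -addrA -splitE; exact: inPz.
- move=> k m; pose w : 'rV[int]_(1 + d) := row_mx k%:Z%:M m.
  have wE : w = row_mx (lsubmx (w *m U) ord0 ord0)%:M (rsubmx (w *m U)) *m V.
    by rewrite -mx11_scalar hsubmxK -mulmxA UV mulmx1.
  (* Only the coordinates c and f of w in the basis V are kept. *)
  move: (_ ord0 ord0) (rsubmx _) wE => c f wE.
  have -> : x + k%:R *: alpha + int_rV R m =
      x + map_mx intr w *m flow_proj alpha.
    by rewrite splitE row_mxKl row_mxKr mxE eqxx mulr1n addrA.
  rewrite wE => /inP cf.
  have c0 := cf i0; rewrite eqxx in c0.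
  pose b := c * g%:Z + (fl c i0 + f ord0 i0).
  have bd : (b %/ g)%Z = c.
    by rewrite /b divzMDl// divz_small ?addr0//=.
  have bm : (b %% g)%Z = fl c i0 + f ord0 i0.
    by rewrite /b modzMDl modz_small//=.
  have zb : z b = w.
    rewrite wE /z bd; congr (row_mx _ _ *m V).
    apply/rowP => i; rewrite mxE bd; case: eqP => [->|/eqP ii0].
      by rewrite bm addrC addKr.
    have := cf i; rewrite (negbTE ii0); move: (fl _ _) (f _ _) => p q; lia.
  exists b; rewrite zb ?row_mxKl ?row_mxKr//.
  by rewrite mxE eqxx mulr1n.
- move=> b b' kb mb.
  have zb : z b = z b'.
    rewrite -[z b]hsubmxK -[z b']hsubmxK mb; congr row_mx.
    by apply/rowP => i; rewrite ord1.
  have /row_mx_inj[cc /rowP/(_ i0)] : row_mx (b %/ g)%Z%:M (e b) =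
      row_mx (b' %/ g)%Z%:M (e b') :> 'rV_(1 + d).
    by rewrite -coordsK -[RHS]coordsK -/(z b) zb.
  rewrite !mxE eqxx cc => /addIr mm.
  by rewrite (divz_eq b g) (divz_eq b' g) cc mm.
- move=> b; set c := (b %/ g)%Z; set k := (lsubmx (z b) ord0 ord0).
  set y := x + (k%:~R *: alpha + int_rV R (rsubmx (z b))).
  have Py : P y by rewrite /y -splitE; exact: inPz.
  have height : (y *m h) ord0 ord0 =
      (x *m h) ord0 ord0 + (c%:~R - k%:~R * rate).
    rewrite mulmxDl mxE; congr (_ + _).
    have kE : map_mx intr (lsubmx (z b)) ord0 ord0 = k%:~R :> R by rewrite mxE.
    rewrite -kE flow_proj_height -map_row_mx hsubmxK -map_mxM mxE.
    congr (_%:~R - _); rewrite colE mulmxA coordsK -colE mxE.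
    transitivity ((row_mx (c%:M : 'M[int]_1) (e b)) ord0 (lshift d ord0)).
      by congr (row_mx _ _ _ _); exact: val_inj.
    by rewrite row_mxEl mxE eqxx mulr1n.
  have yh : `|(y *m h) ord0 ord0| <= \sum_i K%:R * `|h i ord0|.
    rewrite mxE; apply: le_trans (ler_norm_sum _ _ _) _; apply: ler_sum => i _.
    by rewrite normrM ler_wpM2r// PK.
  have bE : b%:~R = c%:~R * g%:R + (b %% g)%Z%:~R :> R.
    by rewrite {1}(divz_eq b g) rmorphD rmorphM/= -pmulrn.
  have m0 : 0 <= (b %% g)%Z%:~R :> R by rewrite ler0z modz_ge0.
  have m1 : (b %% g)%Z%:~R <= g%:R :> R.
    by rewrite (pmulrn _ g) ler_int ltW// ltz_pmod.
  rewrite (_ : _ - _ = (b %% g)%Z%:~R + g%:R * (y *m h) ord0 ord0); last first.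
    by rewrite height bE; ring.
  rewrite /B; apply: le_trans (ler_normD _ _) _; apply: lerD.
    by rewrite ger0_norm.
  by rewrite normrM ger0_norm// ler_wpM2l.
Qed.

(** * Volume from bounded discrepancy *)

(** Integrating the bound over the unit cube gives
    [n (mu S) - n gamma = O(1)] for all [n].  This determines the volume of a
    parallelepiped from the count of visits, without a change of variables. *)
Lemma bounded_discrepancy_measure (R : realType) (d : nat) (alpha : 'rV[R]_d)
    (S : set 'rV[R]_d) (gamma C : R) (K : nat) :
  0 <= gamma -> measurable S ->
  (forall x, S x -> forall i, `|x ord0 i| <= K%:R) ->
  (forall (x : 'rV[R]_d) (n : nat),
    `|\sum_(k < n) chi S (x + k%:R *: alpha) - n%:R * gamma| <= C) ->
  lebesgue_rV R d S = gamma%:E.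
Proof.
move=> gamma0 mS SK SC.
set mu := lebesgue_rV R d; pose Q := @unit_cube R d.
have mQ : measurable Q by exact: measurable_unit_cube.
have C0 : 0 <= C by apply: le_trans (SC 0 0%N).
pose f k x := chi S (x + k%:R *: alpha).
have chi_ge0 (T : set 'rV[R]_d) x : 0 <= chi T x.
  by apply: fsumr_ge0 => m _; rewrite indicE.
have f_ge0 k x : 0 <= f k x by exact: chi_ge0.
have fE k : f k = chi ((fun x => x + k%:R *: alpha) @^-1` S).
  by apply/funext => x; apply: eq_fsbigr => m _; rewrite !indicE -addrA
    (addrC (k%:R *: alpha)) addrA.
have SkK k : exists Kk : nat,
    forall x, ((fun x => x + k%:R *: alpha) @^-1` S) x ->
    forall i, `|x ord0 i| <= Kk%:R.
  exists (K + (Num.trunc (\sum_i `|(k%:R *: alpha) ord0 i|)).+1)%N => x Sx i.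
  have := SK _ Sx i; rewrite mxE => xK.
  rewrite natrD -[x ord0 i](addrK ((k%:R *: alpha) ord0 i)).
  apply: le_trans (ler_normB _ _) _; apply: lerD => //.
  apply: le_trans (ltW (truncnS_gt _)).
  by rewrite (bigD1 i)//= lerDl sumr_ge0.
have mf k : measurable_fun Q (f k).
  rewrite fE; have [Kk SkKk] := SkK k.
  by apply: measurable_chi SkKk; exact: measurable_preimage_shift.
have intf k : (\int[mu]_(x in Q) (f k x)%:E = mu S)%E.
  have [Kk SkKk] := SkK k; under eq_integral do rewrite fE.
  rewrite (integral_chi _ SkKk); first exact: lebesgue_rV_shift.
  exact: measurable_preimage_shift.
have intsum n :
    (\int[mu]_(x in Q) (\sum_(k < n) f k x)%:E = \sum_(k < n) mu S)%E.
  under eq_integral do rewrite -sumEFin.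
  rewrite ge0_integral_sum//.
  - by apply: eq_bigr => k _; exact: intf.
  - by move=> k; apply/measurable_EFinP; exact: mf.
  - by move=> k x _; rewrite lee_fin f_ge0.
have intcst (c : R) : (\int[mu]_(x in Q) c%:E = c%:E)%E.
  by rewrite integral_cst// [X in (_ * X)%E]lebesgue_rV_unit_cube mule1.
have msum n : measurable_fun Q (fun x => \sum_(k < n) f k x).
  exact: measurable_sum.
have upper n : (\sum_(k < n) mu S <= (n%:R * gamma + C)%:E)%E.
  rewrite -intsum -[leRHS]intcst; apply: ge0_le_integral => //.
  - by move=> x _; rewrite lee_fin sumr_ge0.
  - exact/measurable_EFinP.
  - move=> x _; have := SC x n; rewrite lee_fin ler_norml => /andP[_].
    by rewrite -lerBlDl.
have lower n : ((n%:R * gamma)%:E <= \sum_(k < n) mu S + C%:E)%E.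
  rewrite -intsum -[leLHS]intcst -[C%:E]intcst -ge0_integralD//.
  - apply: ge0_le_integral => //.
    + by move=> x _; rewrite lee_fin mulr_ge0.
    + by apply: emeasurable_funD => //; exact/measurable_EFinP.
    + move=> x _; have := SC x n; rewrite lee_fin ler_norml => /andP[? ?].
      by rewrite /f; lra.
  - by move=> x _; rewrite lee_fin sumr_ge0.
  - exact/measurable_EFinP.
(* The case n = 1 of the upper bound makes the measure finite. *)
have muSfin : mu S \is a fin_num.
  rewrite ge0_fin_numE//; apply: le_lt_trans (ltry (1 * gamma + C)).
  by have := upper 1%N; rewrite big_ord1 => /le_trans; apply.
rewrite -(fineK muSfin); congr (_%:E); set r := fine _.
have {}upper n : n%:R * r <= n%:R * gamma + C.
  have := upper n; rewrite -(fineK muSfin) sumEFin lee_fin.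
  by rewrite sumr_const card_ord -[fine _ *+ _]mulr_natl.
have {}lower n : n%:R * gamma <= n%:R * r + C.
  have := lower n; rewrite -(fineK muSfin) sumEFin lee_fin.
  by rewrite sumr_const card_ord -[fine _ *+ _]mulr_natl.
apply/eqP; rewrite -subr_eq0 -normr_eq0; apply/negPn/negP => rg0.
have rg : 0 < `|r - gamma| by rewrite lt0r rg0 normr_ge0.
have := truncnS_gt (C / `|r - gamma|); set n := (Num.trunc _).+1.
rewrite ltr_pdivrMr//; apply/negP; rewrite -leNgt.
rewrite -[n%:R]normr_nat -normrM ler_norml mulrBr.
by have := upper n; have := lower n; lra.
Qed.

Unset Implicit Arguments.

Theorem corollary2 (R : realType) (d : nat) (hd : (1 <= d)%N)
    (alpha : 'rV[R]_d) (halpha : irrational_rV alpha)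
    (n0 : int) (n : 'I_d -> int) (gamma : R)
    (hgamma : gamma = n0%:~R + \sum_(i < d) (n i)%:~R * alpha ord0 i)
    (gamma_gt0 : 0 < gamma) :
  exists (P : set 'rV[R]_d) (v : 'I_d -> 'rV[R]_d),
    [/\ is_parallelepiped_spanned_by P v,
        forall k, Zspan alpha (v k),
        is_BRS alpha P &
        mes R d P = gamma%:E].
Proof.
(* The signs make gamma the value of N on (1, -alpha). *)
pose N : 'cV[int]_(1 + d) := col_mx n0%:M (\col_i - n i).
have gammaE : gamma = crossing_rate alpha (map_mx intr N).
  rewrite /crossing_rate map_col_mx mul_row_col mul1mx hgamma !mxE eqxx mulr1n.
  by congr (_ + _); apply: eq_bigr => i _; rewrite !mxE rmorphN/= mulrNN mulrC.
have N0 : N != 0.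
  apply: contraTneq gamma_gt0 => N0.
  by rewrite gammaE N0 map_mx0 /crossing_rate mulmx0 mxE ltxx.
have [U [g [uU g0 NE]]] := unimodular_of_column N0.
have rateE : gamma = g%:R * crossing_rate alpha (map_mx intr (col ord0 U)).
  by rewrite gammaE NE map_mxZ /crossing_rate -scalemxAr mxE.
have rate_gt0 : 0 < crossing_rate alpha (map_mx intr (col ord0 U)).
  by move: gamma_gt0; rewrite rateE pmulr_rgt0// ltr0n.
have UV : U *m invmx U = 1%:M by exact: mulmxV.
have VU : invmx U *m U = 1%:M by exact: mulVmx.
pose i0 : 'I_d := Ordinal hd.
have [C PC] := parallelepiped_discrepancy i0 UV VU g0 rate_gt0.
have VUR : map_mx intr (invmx U) *m map_mx intr U = 1%:M :> 'M[R]_(1 + d).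
  by rewrite -map_mxM VU map_mx1.
set A := dsubmx _ *m _ in PC; set v := fun i => _ in PC.
have fA : row_free A.
  by apply: (row_free_basis VUR); rewrite -map_col gt_eqF.
have fv : row_free (\matrix_k v k).
  by apply: row_free_scale_rows => // i; rewrite ltr0n; case: ifP.
have [K PK] := parallelepiped_coord_le v.
have mP := measurable_parallelepiped fv.
have muP : lebesgue_rV R d (parallelepiped v) = gamma%:E.
  apply: (bounded_discrepancy_measure (ltW gamma_gt0) mP PK (C := C)) => x m.
  by rewrite rateE; exact: PC.
have mesP : mes R d (parallelepiped v) = gamma%:E.
  by rewrite -muP /mes /completed_measure_extension measurable_mu_extE.
exists (parallelepiped v), v; split=> //.
- move=> k; rewrite /v row_mul scalemxAl -map_dsubmx -map_row pmulrn -map_mxZ.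
  exact: Zspan_flow_proj.
- split.
  + exact: bounded_set_coord PK.
  + exact: caratheodory_measurable_mu_ext.
  + exists C => m m0; apply: aeW => x.
    by rewrite mesP/= rateE; exact: PC.
Qed.
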